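(* Let $A,B,C$ be non-collinear points and let the triangle $A'B'C'$ be a copy of the triangle $ABC$, i.e. $A',B',C'$ are non-collinear with $AB \cong A'B'$, $BC \cong B'C'$, $AC \cong A'C'$. Let $D$ and $E$ be distinct points, each lying on one of the three lines formed by the sides of $ABC$, and let $D'$ and $E'$ be their images under the copying process. Then $D'E' \cong DE$.
   Context: Setting. A plane consists of a set of points, a family of lines (sets of points), a (strict) betweenness relation, and a relation $\cong$ (congruence) on segments, with the following assumptions. Incidence: two distinct points lie on exactly one line; every line has at least two points; there exist three non-collinear points. Order: the points of each line carry a pair of mutually opposite total orders, and $C$ lies between $A$ and $B$ iff it lies strictly between them on their common line for these orders. For $A \ne B$, the segment $AB = BA$ consists of $A$, $B$ and all points between them; between any two distinct points there is another point; every segment can be extended beyond either end. A point $O$ of a line divides the line into two opposite rays based at $O$ having only $O$ in common; $\overrightarrow{OA}$ denotes the ray based at $O$ containing $A\neq O$. Plane separation: each line $l$ partitions the points not on $l$ into two nonempty classes (the sides of $l$); each side is convex (contains the segment $AB$ whenever it contains $A$ and $B$), and a segment with ends on different sides of $l$ meets $l$. Congruence: $\cong$ is an equivalence relation on (undirected) segments. For every segment $AB$ and every ray based at a point $O$ there is a unique point $X \neq O$ on that ray with $OX \cong AB$. Addition and subtraction of segments: let $B$ lie between $A$ and $C$, and $B'$ between $A'$ and $C'$. If two of $AB \cong A'B'$, $BC \cong B'C'$, $AC \cong A'C'$ hold, so does the third. Every segment $BC$ has a midpoint (a point $M$ between $B$ and $C$ with $MB\cong MC$). Axiom T: if $A,B,C$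 are non-collinear points and $A'B' \cong AB$, where $A'$ and $B'$ lie on a line $l$, then on either side of $l$ there is a point $C'$ with $A'C' \cong AC$ and $B'C' \cong BC$. Angles: an angle is a pair of rays, not lying on a common line, with the same base point (its vertex); $\angle XMY$ has rays $\overrightarrow{MX}$, $\overrightarrow{MY}$. If $A,B,C$ are non-collinear with $AB \cong AC$ and $M$ is the midpoint of $BC$, then $\angle AMB$ and $\angle AMC$ are called paired right angles at $M$. A right angle is an angle that is a member of some such pair. Axiom R1: if $\angle BAC$ and $\angle EDF$ are right angles with $AB \cong DE$ and $AC \cong DF$, then $BC \cong EF$. Axiom R2: at most one angle of a triangle (three non-collinear points) is a right angle. Perpendiculars: two distinct lines meeting at $M$ are perpendicular if any two consecutive ones of the four angles they form at $M$ are paired right angles. It is assumed that perpendiculars can be dropped to any line from a point not on it and erected at any point on a line. Images under copying: if $A'B'C'$ is a copy of $ABC$, then for each side, say $AB$, there is a unique congruence-preserving bijection $X\mapsto X'$ (meaning $XY\cong X'Y'$ for distinct $X,Y$) from the line through $A,B$ to the line through $A',B'$ taking $A$ to $A'$ and $B$ to $B'$; similarly for the sides $BC$ and $AC$. The image under the copying process of a point on one of the lines formed by the sides of $ABC$ is its image under the corresponding bijection (the bijections agree at the vertices). *)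

(* Defs.v *)
Set Implicit Arguments.
Unset Strict Implicit.

(* Lines are given as a family of sets of points.  [between A C B] reads "C
   lies between A and B".  [cong A B C D] reads "AB is congruent to CD": a
   relation on undirected segments is encoded as a relation on pairs of end
   points that holds only if A <> B and C <> D, and ignores the order of the
   end points (see [cong_nondegenerate] and [cong_undirected]). *)
Record plane_data : Type := PlaneData {
  point : Type;
  line : Type;
  lies_on : point -> line -> Prop;
  between : point -> point -> point -> Prop;
  cong : point -> point -> point -> point -> Prop
}.

Section Notions.

Context {P : plane_data}.
Implicit Types (A B C D E M O U V X Y Z : point P) (l m : line P).

Definition collinear A B C : Prop :=
  exists l, lies_on A l /\ lies_on B l /\ lies_on C l.

Definition segment A B X : Prop := X = A \/ X = B \/ between A X B.

(* The ray based at O containing A, meaningful for A <> O. *)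
Definition ray O A X : Prop :=
  X = O \/ X = A \/ between O X A \/ between O A X.

Record strict_total_order_on (S : point P -> Prop)
    (lt : point P -> point P -> Prop) : Prop := {
  lt_irrefl : forall X, S X -> ~ lt X X;
  lt_trans : forall X Y Z, S X -> S Y -> S Z -> lt X Y -> lt Y Z -> lt X Z;
  lt_total : forall X Y, S X -> S Y -> lt X Y \/ X = Y \/ lt Y X
}.

Definition convex (S : point P -> Prop) : Prop :=
  forall A B X, S A -> S B -> A <> B -> segment A B X -> S X.

(* S and T are the two sides of l. *)
Record sides l (S T : point P -> Prop) : Prop := {
  sides_cover : forall X, ~ lies_on X l <-> S X \/ T X;
  sides_disjoint : forall X, ~ (S X /\ T X);
  sides_nonempty : (exists X, S X) /\ (exists X, T X);
  sides_convex : convex S /\ convex T;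
  sides_cross : forall A B, S A -> T B -> exists X, segment A B X /\ lies_on X l
}.

Definition midpoint M B C : Prop := between B M C /\ cong M B M C.

Definition same_ray O A B : Prop := forall X, ray O A X <-> ray O B X.

(* The angles XMY and UMV are equal as unordered pairs of rays. *)
Definition same_angle M X Y U V : Prop :=
  (same_ray M X U /\ same_ray M Y V) \/ (same_ray M X V /\ same_ray M Y U).

(* The angles XMY and UMV are paired right angles at M. *)
Definition paired_right_angles M X Y U V : Prop :=
  exists A B C,
    ~ collinear A B C /\ cong A B A C /\ midpoint M B C /\
    same_angle M X Y A B /\ same_angle M U V A C.

(* The angle XMY, with vertex M, is a right angle.  It suffices to consider
   the first member of a pair, since B and C play symmetric roles in
   [paired_right_angles]. *)
Definition right_angle X M Y : Prop :=
  exists U V, paired_right_angles M X Y U V.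

(* Two of the four angles formed by l and m at M are consecutive when they
   share a ray of one line and their other rays are the two opposite rays of
   the other line. *)
Definition perpendicular_at l m M : Prop :=
  l <> m /\ lies_on M l /\ lies_on M m /\
  (forall A B B', lies_on A l -> A <> M -> lies_on B m -> lies_on B' m ->
     between B M B' -> paired_right_angles M A B A B') /\
  (forall A B B', lies_on A m -> A <> M -> lies_on B l -> lies_on B' l ->
     between B M B' -> paired_right_angles M A B A B').

Definition perpendicular l m : Prop := exists M, perpendicular_at l m M.

(* f restricts to a congruence-preserving bijection from the line l through A
   and B to the line l' through A' and B', taking A to A' and B to B'.  The
   values of f outside l are irrelevant. *)
Record copy_map A B A' B' l l' (f : point P -> point P) : Prop := {
  copy_dom : lies_on A l /\ lies_on B l;
  copy_cod : lies_on A' l' /\ lies_on B' l';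
  copy_maps : forall X, lies_on X l -> lies_on (f X) l';
  copy_inj : forall X Y, lies_on X l -> lies_on Y l -> f X = f Y -> X = Y;
  copy_surj : forall Y, lies_on Y l' -> exists X, lies_on X l /\ f X = Y;
  copy_cong : forall X Y, lies_on X l -> lies_on Y l -> X <> Y ->
    cong X Y (f X) (f Y);
  copy_ends : f A = A' /\ f B = B'
}.

(* X lies on the line through A and B, and X' is its image. *)
Definition side_image A B A' B' X X' : Prop :=
  exists l l' f, copy_map A B A' B' l l' f /\ lies_on X l /\ f X = X'.

(* X lies on one of the three lines formed by the sides of ABC, and X' is its
   image under the copying process taking ABC to A'B'C'. *)
Definition copy_image A B C A' B' C' X X' : Prop :=
  side_image A B A' B' X X' \/
  side_image B C B' C' X X' \/
  side_image A C A' C' X X'.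

(* A'B'C' is a copy of ABC. *)
Definition is_copy A B C A' B' C' : Prop :=
  ~ collinear A' B' C' /\ cong A B A' B' /\ cong B C B' C' /\ cong A C A' C'.

End Notions.

Record plane_axioms (P : plane_data) : Prop := {
  line_exists : forall A B : point P, A <> B ->
    exists l, lies_on A l /\ lies_on B l;
  line_unique : forall (A B : point P) (l m : line P), A <> B ->
    lies_on A l -> lies_on B l -> lies_on A m -> lies_on B m -> l = m;
  line_two_points : forall l : line P,
    exists A B, A <> B /\ lies_on A l /\ lies_on B l;
  noncollinear_exist : exists A B C : point P, ~ collinear A B C;

  (* The opposite of lt is the other order carried by l. *)
  line_order : forall l : line P,
    exists lt, strict_total_order_on (fun X => lies_on X l) lt /\
      forall A B C, lies_on A l -> lies_on B l ->
        (between A C B <->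
         lies_on C l /\ ((lt A C /\ lt C B) \/ (lt B C /\ lt C A)));
  between_dense : forall A B : point P, A <> B -> exists C, between A C B;
  between_extend : forall A B : point P, A <> B -> exists C, between A B C;

  plane_separation : forall l : line P, exists S T, sides l S T;

  cong_nondegenerate : forall A B C D : point P,
    cong A B C D -> A <> B /\ C <> D;
  cong_undirected : forall A B C D : point P, cong A B C D -> cong B A C D;
  cong_refl : forall A B : point P, A <> B -> cong A B A B;
  cong_sym : forall A B C D : point P, cong A B C D -> cong C D A B;
  cong_trans : forall A B C D E F : point P,
    cong A B C D -> cong C D E F -> cong A B E F;
  cong_transport : forall A B O Q : point P, A <> B -> Q <> O ->
    exists! X, X <> O /\ ray O Q X /\ cong O X A B;
  cong_add_sub : forall A B C A' B' C' : point P,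
    between A B C -> between A' B' C' ->
    (cong A B A' B' -> cong B C B' C' -> cong A C A' C') /\
    (cong A B A' B' -> cong A C A' C' -> cong B C B' C') /\
    (cong B C B' C' -> cong A C A' C' -> cong A B A' B');
  midpoint_exists : forall B C : point P, B <> C -> exists M, midpoint M B C;

  (* [sides] is symmetric in S and T, so C' can be found on either side. *)
  axiom_T : forall (A B C A' B' : point P) (l : line P) (S T : point P -> Prop),
    ~ collinear A B C -> cong A' B' A B -> lies_on A' l -> lies_on B' l ->
    sides l S T ->
    exists C', S C' /\ cong A' C' A C /\ cong B' C' B C;

  axiom_R1 : forall A B C D E F : point P,
    right_angle B A C -> right_angle E D F ->
    cong A B D E -> cong A C D F -> cong B C E F;
  axiom_R2 : forall A B C : point P, ~ collinear A B C ->
    ~ (right_angle B A C /\ right_angle A B C);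

  perpendicular_drop : forall (A : point P) (l : line P), ~ lies_on A l ->
    exists m, lies_on A m /\ perpendicular l m;
  perpendicular_erect : forall (A : point P) (l : line P), lies_on A l ->
    exists m, perpendicular_at l m A
}.

(* Main.v *)
Require Import Defs.
From Stdlib Require Import Classical.

(** There is no side-angle-side axiom here, only its case for right angles (R1),
    so everything is reduced to right triangles.

    The heart is the case where one point is the apex [C] and the other lies on
    the opposite side line [AB] ([copy_apex]).  Let [F] be the foot of the
    perpendicular from [C] to [AB] and [F'] its image.  On the perpendicular to
    [A'B'] at [F'] put [Q], on the side of [C'], with [F'Q] congruent to [FC].
    By R1 every [X] on [AB] satisfies [CX] congruent to [QX'], in particular for
    [X = A] and [X = B]; so [Q] is at the same distances from [A'] and [B'] as
    [C'], and the result follows once [Q = C'].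

    That a point on a given side of a line is determined by its distances from
    two points of the line ([apex_unique]) comes from the uniqueness of
    perpendiculars: if [C] and [C'] were two such points, [A] and [B] would both
    lie on the perpendicular to [CC'] at its midpoint, which would then be the
    line [AB] and would meet the segment [CC'].  And the erected perpendicular
    is unique ([perpendicular_bisector]) since two of them would produce a
    triangle with two right angles, against R2.

    For [D] on [AB] and [E] on [AC], the case of the apex gives that [CD] is
    congruent to [C'D'], so that [A'C'D'] is a copy of [ACD]; the same case,
    applied to this triangle with apex [D], gives [DE] ([copy_adjacent_sides]).
    For two points on one side line it must only be seen that their images come
    from the same bijection ([copy_same_side]): a point of a line is determined
    by its distances from two points of the line. *)

Section CopiedTriangles.

Context {P : plane_data} (hP : plane_axioms P).
Implicit Types (A B C D E F M O Q T U V W X Y Z : point P) (k l m n : line P).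

(** * Order on a line *)

(** Restricting the order to [l] makes transitivity and irreflexivity
    unconditional, so that impossible configurations on one line can be refuted
    by chaining inequalities, as [order_solve] does. *)
Lemma line_order_spec l : exists lt : point P -> point P -> Prop,
  (forall X, ~ lt X X) /\
  (forall X Y Z, lt X Y -> lt Y Z -> lt X Z) /\
  (forall X Y, lies_on X l -> lies_on Y l -> lt X Y \/ X = Y \/ lt Y X) /\
  (forall A B C, lies_on A l -> lies_on B l -> lies_on C l ->
    (between A C B <-> (lt A C /\ lt C B) \/ (lt B C /\ lt C A))).
Proof.
  destruct (line_order hP l) as [lt [[irr tr tot] btw]].
  exists (fun X Y => lies_on X l /\ lies_on Y l /\ lt X Y).
  split; [|split; [|split]].
  - intros X [hX [_ h]]. exact (irr X hX h).
  - intros X Y Z [hX [hY h]] [_ [hZ h']].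
    split; [|split]; eauto.
  - intros X Y hX hY. destruct (tot X Y hX hY) as [h|[h|h]]; auto.
  - intros A B C hA hB hC. rewrite (btw A B C hA hB). tauto.
Qed.

(** The bounds must differ: a line is found through two distinct points, and the
    axiom relating betweenness to order speaks of a line through the bounds. *)
Lemma between_line A B C : between A C B -> A <> B ->
  exists l, lies_on A l /\ lies_on B l /\ lies_on C l.
Proof.
  intros h hne. destruct (line_exists hP hne) as [l [hA hB]].
  destruct (line_order hP l) as [lt [_ btw]].
  exists l. split; [|split]; auto. apply (btw A B C hA hB), h.
Qed.

Lemma between_on A B C l :
  between A C B -> A <> B -> lies_on A l -> lies_on B l -> lies_on C l.
Proof.
  intros h hne hA hB. destruct (line_order hP l) as [lt [_ btw]].
  apply (btw A B C hA hB), h.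
Qed.

Ltac order_solve :=
  exfalso;
  repeat match goal with
    | H : _ \/ _ |- _ => destruct H
    | H : _ /\ _ |- _ => destruct H
    end;
  subst;
  match goal with
  | irr : forall X, ~ ?lt X X, tr : forall X Y Z, ?lt X Y -> _ |- _ =>
      repeat match goal with
        | H : lt ?X ?Y, H' : lt ?Y ?Z |- _ =>
            lazymatch goal with
            | _ : lt X Z |- _ => fail
            | _ => pose proof (tr _ _ _ H H')
            end
        end;
      match goal with H : lt ?X ?X |- _ => exact (irr X H) end
  end.

Lemma between_sym A B C : A <> B -> between A C B -> between B C A.
Proof.
  intros hne h. destruct (between_line A B C h hne) as [l [hA [hB hC]]].
  destruct (line_order_spec l) as [lt [_ [_ [_ btw]]]].
  apply btw; auto. apply btw in h; auto. tauto.
Qed.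

Lemma between_neq A B C : between A C B -> A <> B -> A <> C /\ C <> B.
Proof.
  intros h hne. destruct (between_line A B C h hne) as [l [hA [hB hC]]].
  destruct (line_order_spec l) as [lt [irr [_ [_ btw]]]].
  apply btw in h; auto.
  split; intros ->; destruct h as [[? ?]|[? ?]]; eapply irr; eauto.
Qed.

Lemma between_ends_neq A B C : between A C B -> A <> C -> A <> B.
Proof.
  intros h hne <-. destruct (line_exists hP hne) as [l [hA hC]].
  destruct (line_order_spec l) as [lt [irr [tr [_ btw]]]].
  apply btw in h; auto.
  destruct h as [[? ?]|[? ?]]; eapply irr; eauto.
Qed.

Lemma between_end_on A B C l :
  between A C B -> A <> C -> lies_on A l -> lies_on C l -> lies_on B l.
Proof.
  intros h hne hA hC.
  destruct (between_line A B C h (between_ends_neq A B C h hne)) as [k [kA [kB kC]]].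
  now rewrite (line_unique hP hne hA hC kA kC).
Qed.

(** On a line the ray from [O] through [A] is the half of the order on which [A]
    lies.  This turns every question about rays into one about signs. *)
Lemma ray_order O A X l (lt : point P -> point P -> Prop) :
  (forall X Y Z, lt X Y -> lt Y Z -> lt X Z) ->
  (forall X, ~ lt X X) ->
  (forall X Y, lies_on X l -> lies_on Y l -> lt X Y \/ X = Y \/ lt Y X) ->
  (forall A B C, lies_on A l -> lies_on B l -> lies_on C l ->
    (between A C B <-> (lt A C /\ lt C B) \/ (lt B C /\ lt C A))) ->
  A <> O -> lies_on O l -> lies_on A l -> lies_on X l -> X <> O ->
  (ray O A X <-> (lt O A /\ lt O X) \/ (lt A O /\ lt X O)).
Proof.
  intros tr irr tot btw hA lO lA lX hX.
  unfold ray. rewrite (btw O A X), (btw O X A) by auto.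
  destruct (tot O A) as [h|[h|h]]; auto; [| congruence |];
  (destruct (tot O X) as [h'|[h'|h']]; auto; [| congruence |]);
  (destruct (tot A X) as [h''|[h''|h'']]; auto);
  split; intros; first [tauto | subst; tauto | order_solve].
Qed.

Lemma ray_on O A X l : A <> O -> lies_on O l -> lies_on A l -> ray O A X -> lies_on X l.
Proof.
  intros hne hO hA [->|[->|[h|h]]]; auto.
  - apply (between_on O A X); auto.
  - apply (between_end_on O X A); auto.
Qed.

Lemma ray_or_opposite O A X l : A <> O -> X <> O ->
  lies_on O l -> lies_on A l -> lies_on X l -> ray O A X \/ between A O X.
Proof.
  intros hA hX lO lA lX.
  destruct (line_order_spec l) as [lt [irr [tr [tot btw]]]].
  rewrite (ray_order O A X l lt), (btw A X O); auto.
  destruct (tot O A) as [h|[h|h]]; auto; [| congruence |];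
  (destruct (tot O X) as [h'|[h'|h']]; auto; congruence).
Qed.

Lemma ray_not_opposite O A X : A <> O -> ray O A X -> ~ between A O X.
Proof.
  intros hA h h'.
  destruct (line_exists hP hA) as [l [lA lO]].
  assert (lX : lies_on X l) by (apply (ray_on O A); auto).
  destruct (line_order_spec l) as [lt [irr [tr [tot btw]]]].
  assert (hX : X <> O).
  { intros ->. apply (between_neq A O O) in h'; tauto. }
  apply (ray_order O A X l lt) in h; auto.
  apply (btw A X O) in h'; auto. order_solve.
Qed.

Lemma ray_same O A X : A <> O -> X <> O -> ray O A X -> same_ray O A X.
Proof.
  intros hA hX h.
  assert (lOX : exists l, lies_on O l /\ lies_on A l /\ lies_on X l).
  { destruct (line_exists hP hA) as [l [lA lO]].
    exists l. split; [|split]; auto. apply (ray_on O A); auto. }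
  destruct lOX as [l [lO [lA lX]]].
  destruct (line_order_spec l) as [lt [irr [tr [tot btw]]]].
  apply (ray_order O A X l lt) in h; auto.
  intros Y. destruct (classic (Y = O)) as [->|hY]; [unfold ray; tauto|].
  split; intros hr.
  - assert (lY : lies_on Y l) by (apply (ray_on O A); auto).
    apply (ray_order O A Y l lt) in hr; auto.
    apply (ray_order O X Y l lt); auto.
    destruct h as [[? ?]|[? ?]], hr as [[? ?]|[? ?]]; auto; order_solve.
  - assert (lY : lies_on Y l) by (apply (ray_on O X); auto).
    apply (ray_order O X Y l lt) in hr; auto.
    apply (ray_order O A Y l lt); auto.
    destruct h as [[? ?]|[? ?]], hr as [[? ?]|[? ?]]; auto; order_solve.
Qed.

Lemma same_ray_refl O A : same_ray O A A.
Proof. intros X; tauto. Qed.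

Lemma between_shift Y A B Z : Y <> B -> A <> Z ->
  between Y A B -> between A B Z -> between Y A Z /\ between Y B Z.
Proof.
  intros hYB hAZ h h'.
  destruct (between_line Y B A h hYB) as [l [lY [lB lA]]].
  destruct (between_neq Y B A h hYB) as [_ hAB].
  assert (lZ : lies_on Z l) by (apply (between_end_on A Z B); auto).
  destruct (line_order_spec l) as [lt [irr [tr [tot btw]]]].
  rewrite btw in h, h' |- * by auto. rewrite btw by auto.
  destruct h as [[? ?]|[? ?]], h' as [[? ?]|[? ?]];
    try solve [order_solve]; split; eauto 6.
Qed.

(** * Congruence on a line *)

Lemma cong_swap A B C D : cong A B C D -> cong A B D C.
Proof.
  intros h. apply (cong_sym hP), (cong_undirected hP), (cong_sym hP), h.
Qed.

(** Up to reversal of the two segments and symmetry. *)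
Ltac cong_flip :=
  first [ assumption
        | apply (cong_sym hP); assumption
        | apply cong_swap; assumption
        | apply (cong_undirected hP); assumption
        | apply (cong_sym hP); apply cong_swap; assumption
        | apply (cong_undirected hP); apply cong_swap; assumption
        | apply (cong_sym hP); apply (cong_undirected hP); assumption
        | apply (cong_sym hP); apply (cong_undirected hP); apply cong_swap; assumption ].

Lemma ray_point_unique O Q X Y : Q <> O -> X <> O -> Y <> O ->
  ray O Q X -> ray O Q Y -> cong O X O Y -> X = Y.
Proof.
  intros hQ hX hY rX rY h.
  assert (hne : O <> Y) by auto.
  destruct (cong_transport hP hne hQ) as [Z [_ u]].
  rewrite <- (u X), <- (u Y); auto.
  split; [|split]; auto. apply (cong_refl hP); auto.
Qed.

Lemma equidistant_between A Y Z l : lies_on A l -> lies_on Y l -> lies_on Z l ->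
  cong A Y A Z -> Y <> Z -> between Y A Z.
Proof.
  intros lA lY lZ h hne.
  destruct (cong_nondegenerate hP h) as [hY hZ].
  destruct (ray_or_opposite A Y Z l) as [r|r]; auto.
  exfalso. apply hne, (ray_point_unique A Y); auto. unfold ray; auto.
Qed.

(** If [A] and [B] were both midpoints of [YZ], in this order, then [YA] would be
    congruent to [ZA], which is [ZB] prolonged by [BA], hence to [YB] prolonged
    by a copy [BT] of [BA]: a proper extension of [YA] congruent to [YA]. *)
Lemma no_two_midpoints Y A B Z : Y <> B -> A <> Z -> between Y A B -> between A B Z ->
  cong A Y A Z -> cong B Y B Z -> False.
Proof.
  intros hYB hAZ h h' cA cB.
  destruct (between_neq Y B A h hYB) as [hYA hAB].
  destruct (between_neq A Z B h' hAZ) as [_ hBZ].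
  (* T is the copy of A on the ray from B opposite to the one through A. *)
  destruct (cong_transport hP hAB (not_eq_sym hBZ)) as [T [[hT [rT cT]] _]].
  assert (l0 : exists l, lies_on A l /\ lies_on B l /\ lies_on Z l).
  { destruct (between_line A Z B h' hAZ) as [l [? [? ?]]]; eauto. }
  destruct l0 as [l [lA [lB lZ]]].
  assert (lT : lies_on T l) by (apply (ray_on B Z); auto).
  assert (bT : between A B T).
  { destruct (ray_or_opposite B A T l) as [r|r]; auto.
    exfalso. apply (ray_not_opposite B A Z); auto.
    apply (ray_same B Z T) in rT; auto.
    apply (ray_same B A T) in r; auto.
    apply r, rT. unfold ray; auto. }
  assert (hAT : A <> T) by (apply (between_ends_neq A T B); auto).
  destruct (between_shift Y A B T hYB hAT h bT) as [b1 b2].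
  destruct (cong_add_sub hP b2 (between_sym A Z B hAZ h')) as [add _].
  assert (c : cong Y T Z A).
  { apply add; cong_flip. }
  apply (between_neq Y T A) in b1 as e.
  - apply e, (ray_point_unique Y A); try (unfold ray; tauto); auto.
    + intros <-. apply (cong_nondegenerate hP) in c; tauto.
    + apply (cong_sym hP), (cong_trans hP c). cong_flip.
  - apply (cong_nondegenerate hP) in c; tauto.
Qed.

Lemma two_distances_determine A B Y Z l : A <> B ->
  lies_on A l -> lies_on B l -> lies_on Y l -> lies_on Z l ->
  cong A Y A Z -> cong B Y B Z -> Y = Z.
Proof.
  intros hne lA lB lY lZ cA cB. apply NNPP; intros hYZ.
  assert (bA : between Y A Z) by (apply (equidistant_between A Y Z l); auto).
  assert (bB : between Y B Z) by (apply (equidistant_between B Y Z l); auto).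
  destruct (between_neq Y Z A bA hYZ), (between_neq Y Z B bB hYZ).
  assert (o : (between Y A B /\ between A B Z) \/ (between Y B A /\ between B A Z)).
  { destruct (line_order_spec l) as [lt [irr [tr [tot btw]]]].
    rewrite btw in bA, bB by auto. rewrite !btw by auto.
    destruct (tot A B lA lB) as [?|[?|?]], bA as [?|?], bB as [?|?];
      first [tauto | order_solve]. }
  destruct o as [[? ?]|[? ?]]; [eapply (no_two_midpoints Y A B Z)|eapply (no_two_midpoints Y B A Z)]; eauto.
Qed.

(** * Sides of a line *)

Lemma sides_sym l (S T : point P -> Prop) : sides l S T -> sides l T S.
Proof.
  intros [cov dis [ne1 ne2] [cv1 cv2] cr]. split; auto.
  - intros X. rewrite cov. tauto.
  - intros X [? ?]. apply (dis X); auto.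
  - intros A B hA hB. destruct (cr B A hB hA) as [X [s hX]].
    exists X. split; auto.
    destruct s as [->|[->|s]]; unfold segment; auto.
    right; right. apply between_sym; auto.
    intros ->. apply (dis A); auto.
Qed.

Lemma side_off l (S T : point P -> Prop) X : sides l S T -> S X -> ~ lies_on X l.
Proof. intros h hX. apply (sides_cover h). auto. Qed.

Lemma side_containing l X : ~ lies_on X l ->
  exists S T : point P -> Prop, sides l S T /\ S X.
Proof.
  intros lX. destruct (plane_separation hP l) as [S [T h]].
  destruct (proj1 (sides_cover h X) lX);
    [exists S, T | exists T, S]; auto using sides_sym.
Qed.

(** If [Q] and [X] were on one side, so would be the point [O] of [l] between
    them, by convexity. *)
Lemma side_opposite l m (S T : point P -> Prop) O Q X : sides l S T ->
  lies_on O l -> lies_on O m -> lies_on Q m -> S Q -> between Q O X -> T X.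
Proof.
  intros h lO mO mQ hQ b.
  assert (hQO : Q <> O) by (intros ->; apply (side_off l S T O); auto).
  assert (hQX : Q <> X) by (apply (between_ends_neq Q X O); auto).
  assert (hX : ~ lies_on X l).
  { intros lX. apply (side_off l S T Q h hQ).
    apply (between_end_on X Q O); auto.
    - apply between_sym; auto.
    - intros ->. apply (between_neq Q O O) in b; tauto. }
  apply (sides_cover h) in hX as [hX|hX]; auto.
  exfalso. apply (side_off l S T O h); auto.
  apply (proj1 (sides_convex h) Q X); auto. unfold segment; auto.
Qed.

(** If [X] were on the other side, segment [QX] would meet [l], necessarily in
    [O], which is not between two points of a ray based at [O]. *)
Lemma side_ray l (S T : point P -> Prop) O Q X : sides l S T ->
  lies_on O l -> S Q -> X <> O -> ray O Q X -> S X.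
Proof.
  intros h lO hQ hX r.
  assert (hQO : Q <> O) by (intros ->; apply (side_off l S T O); auto).
  destruct (line_exists hP hQO) as [m [mQ mO]].
  assert (mX : lies_on X m) by (apply (ray_on O Q); auto).
  assert (hXl : ~ lies_on X l).
  { intros lX. apply (side_off l S T Q h hQ).
    now rewrite (line_unique hP hX lX lO mX mO). }
  apply (sides_cover h) in hXl as [hXl|hXl]; auto.
  exfalso.
  destruct (between_extend hP hQO) as [Y bY].
  destruct (sides_cross h hQ hXl) as [Z [s lZ]].
  assert (hQX : Q <> X) by (intros ->; apply (sides_disjoint h (X:=X)); auto).
  destruct s as [->|[->|s]].
  - apply (side_off l S T Q); auto.
  - apply (side_off l T S X (sides_sym l S T h)); auto.
  - assert (mZ : lies_on Z m) by (apply (between_on Q X Z); auto).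
    destruct (classic (Z = O)) as [->|hZ].
    + apply (ray_not_opposite O Q X); auto.
    + apply (side_off l S T Q h hQ).
      now rewrite (line_unique hP hZ lZ lO mZ mO).
Qed.

Lemma point_on_side l m (S T : point P -> Prop) O A B : sides l S T ->
  l <> m -> lies_on O l -> lies_on O m -> A <> B ->
  exists X, lies_on X m /\ S X /\ cong O X A B.
Proof.
  intros h hlm lO mO hAB.
  assert (q : exists Q, lies_on Q m /\ S Q).
  { assert (q : exists Q, lies_on Q m /\ Q <> O).
    { destruct (line_two_points hP m) as [Q [R [hQR [mQ mR]]]].
      destruct (classic (Q = O)) as [->|hQ]; [exists R | exists Q]; auto. }
    destruct q as [Q [mQ hQ]].
    assert (lQ : ~ lies_on Q l).
    { intros lQ. exact (hlm (line_unique hP hQ lQ lO mQ mO)). }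
    apply (sides_cover h) in lQ as [sQ|tQ]; [exists Q; auto|].
    destruct (between_extend hP hQ) as [R b].
    exists R. split.
    - apply (between_end_on Q R O); auto.
    - apply (side_opposite l m T S O Q R (sides_sym l S T h)); auto. }
  destruct q as [Q [mQ sQ]].
  assert (hQ : Q <> O) by (intros ->; apply (side_off l S T O); auto).
  destruct (cong_transport hP hAB hQ) as [X [[hX [r c]] _]].
  exists X. split; [|split]; auto.
  - apply (ray_on O Q); auto.
  - apply (side_ray l S T O Q); auto.
Qed.

(** * Right angles and perpendiculars *)

Lemma right_angle_sym A M B : right_angle A M B -> right_angle B M A.
Proof.
  intros [U [V [X [Y [Z [h1 [h2 [h3 [h4 h5]]]]]]]]].
  exists U, V, X, Y, Z. unfold same_angle in *. tauto.
Qed.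

Lemma collinear_on A B C l : A <> B -> lies_on A l -> lies_on B l ->
  collinear A B C -> lies_on C l.
Proof.
  intros hne lA lB [k [kA [kB kC]]].
  now rewrite (line_unique hP hne lA lB kA kB).
Qed.

Lemma midpoint_neq M B C : midpoint M B C -> B <> C.
Proof.
  intros [b c]. apply (between_ends_neq B C M); auto.
  apply (cong_nondegenerate hP) in c. intuition.
Qed.

Lemma midpoint_end_neq M B C : midpoint M B C -> B <> M.
Proof. intros [_ c]. apply (cong_nondegenerate hP) in c. intuition. Qed.

Lemma midpoint_sym M B C : midpoint M B C -> midpoint M C B.
Proof.
  intros h. assert (hne := midpoint_neq M B C h). destruct h as [b c]. split.
  - apply between_sym; auto.
  - cong_flip.
Qed.

(** Allowing [W] on either of the two opposite rays costs nothing, since the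
    isosceles triangle gives a right angle with each half of its base. *)
Lemma right_angle_isosceles A B C M W n : ~ collinear A B C -> cong A B A C ->
  midpoint M B C -> lies_on B n -> lies_on C n -> lies_on W n -> W <> M ->
  right_angle A M W.
Proof.
  intros nc c hM nB nC nW hW.
  assert (hBC := midpoint_neq M B C hM).
  assert (nM : lies_on M n) by (apply (between_on B C M); auto; apply hM).
  assert (hB := midpoint_end_neq M B C hM).
  assert (hC := midpoint_end_neq M C B (midpoint_sym M B C hM)).
  assert (r : ray M B W \/ ray M C W).
  { destruct (ray_or_opposite M B W n) as [r|r]; auto.
    destruct (ray_or_opposite M C W n) as [r'|r']; auto.
    destruct hM as [b _].
    destruct (line_order_spec n) as [lt [irr [tr [_ btw]]]].
    rewrite btw in b, r, r' by auto. order_solve. }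
  destruct r as [r|r].
  - exists A, C, A, B, C. split; [|split; [|split; [|split]]]; auto.
    + left. split; [apply same_ray_refl|].
      intros X. symmetry. apply ray_same; auto.
    + left. split; apply same_ray_refl.
  - exists A, B, A, C, B. split; [|split; [|split; [|split]]].
    + intros [k [? [? ?]]]; apply nc; exists k; auto.
    + cong_flip.
    + apply midpoint_sym, hM.
    + left. split; [apply same_ray_refl|].
      intros X. symmetry. apply ray_same; auto.
    + left. split; apply same_ray_refl.
Qed.

Lemma perpendicular_right_angle l m M A B : perpendicular_at l m M ->
  lies_on A l -> lies_on B m -> A <> M -> B <> M -> right_angle A M B.
Proof.
  intros [_ [_ [mM [h _]]]] lA mB hA hB.
  destruct (between_extend hP hB) as [B' b].
  exists A, B'. apply h; auto. apply (between_end_on B B' M); auto.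
Qed.

(** Uniqueness of the perpendicular erected at [M].  If [A] is off [m], choose [B]
    on [m], across [n] from [A], with [MB] congruent to [MA].  The segment [AB]
    crosses [n] at some [W] other than [M].  As [AMW] and [BMW] are right, R1
    makes [W] the midpoint of the base of the isosceles triangle [MAB]; so [WMA]
    has right angles at both [M] and [W]. *)
Lemma perpendicular_bisector A U V M n m : ~ collinear A U V -> cong A U A V ->
  midpoint M U V -> lies_on U n -> lies_on V n -> perpendicular_at n m M ->
  lies_on A m.
Proof.
  intros nc c hM nU nV hp.
  apply NNPP; intros hA.
  assert (hUV : U <> V) by (apply (midpoint_neq M); auto).
  assert (nA : ~ lies_on A n) by (intros nA; apply nc; exists n; auto).
  assert (hp' := hp). destruct hp' as [hnm [nM [mM _]]].
  destruct (side_containing n A nA) as [S [T [hS sA]]].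
  assert (hMA : M <> A) by congruence.
  destruct (point_on_side n m T S M M A (sides_sym n S T hS) hnm nM mM hMA)
    as [B [mB [tB cB]]].
  assert (hBM : B <> M).
  { intros ->. apply (cong_nondegenerate hP) in cB; tauto. }
  assert (hAB : A <> B) by (intros ->; tauto).
  destruct (sides_cross hS sA tB) as [W [s nW]].
  assert (b : between A W B).
  { destruct s as [->|[->|s]]; auto; exfalso; [tauto|].
    apply (side_off n T S B (sides_sym n S T hS)); auto. }
  assert (hW : W <> M).
  { intros ->. apply hA. apply (between_end_on B A M); auto using between_sym. }
  assert (rA : right_angle A M W) by (apply (right_angle_isosceles A U V M W n); auto).
  assert (rB : right_angle W M B).
  { apply (perpendicular_right_angle n m); auto. }
  assert (hw : midpoint W A B).
  { split; auto. assert (cW : cong M W M W) by (apply (cong_refl hP); auto).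
    assert (cA : cong M A M B) by cong_flip.
    assert (cc := axiom_R1 hP rA (right_angle_sym _ _ _ rB) cA cW). cong_flip. }
  assert (nMAB : ~ collinear M A B).
  { intros [k [? [? ?]]]. apply hA. apply (collinear_on M B A m); auto. exists k; auto. }
  assert (rW : right_angle M W A).
  { destruct (line_exists hP hAB) as [k [kA kB]].
    apply (right_angle_isosceles M A B W A k); auto; [cong_flip | congruence]. }
  apply (axiom_R2 hP (A:=W) (B:=M) (C:=A)).
  - intros hc. apply nA. apply (collinear_on W M A n); auto.
  - split; auto using right_angle_sym.
Qed.

(** * Images of points on the sides *)

(** A point of [l] equidistant from [C] and [C'] is not on line [CC'], as it would
    then lie between them; so it is on the perpendicular at their midpoint. *)
Lemma apex_unique A B C C' l (S T : point P -> Prop) : A <> B ->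
  lies_on A l -> lies_on B l -> sides l S T -> S C -> S C' ->
  cong A C A C' -> cong B C B C' -> C = C'.
Proof.
  intros hAB lA lB hS sC sC' cA cB. apply NNPP; intros hne.
  destruct (line_exists hP hne) as [n [nC nC']].
  destruct (midpoint_exists hP hne) as [M hM].
  assert (off : forall X, between C X C' -> ~ lies_on X l).
  { intros X b. apply (side_off l S T X hS).
    apply (proj1 (sides_convex hS) C C'); auto. unfold segment; auto. }
  assert (nM : lies_on M n) by (apply (between_on C C' M); auto; apply hM).
  destruct (perpendicular_erect hP nM) as [m hm].
  assert (on : forall X, lies_on X l -> cong X C X C' -> lies_on X m).
  { intros X lX cX.
    apply (perpendicular_bisector X C C' M n m); auto.
    intros [k [kX [kC kC']]].
    apply (off X); auto.
    apply (equidistant_between X C C' k); auto. }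
  apply (off M); [apply hM|].
  rewrite (line_unique hP hAB lA lB (on A lA cA) (on B lB cB)).
  destruct hm as [_ [_ [h _]]]; exact h.
Qed.

(** The apex [C'] is compared with the point [Q] obtained by copying the right
    triangles cut off by the altitude from [C]. *)
Lemma copy_apex A B C A' B' C' l l' f X : ~ collinear A B C ->
  is_copy A B C A' B' C' -> copy_map A B A' B' l l' f -> lies_on X l ->
  cong C X C' (f X).
Proof.
  intros nc [nc' [cAB [cBC cAC]]] [[lA lB] [lA' lB'] maps inj _ cg [fA fB]] lX.
  assert (lC : ~ lies_on C l) by (intros lC; apply nc; exists l; auto).
  assert (lC' : ~ lies_on C' l') by (intros h; apply nc'; exists l'; auto).
  destruct (cong_nondegenerate hP cAB) as [hAB hAB'].
  destruct (perpendicular_drop hP lC) as [m [mC [F hm]]].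
  assert (lF : lies_on F l) by (destruct hm as [_ [h _]]; exact h).
  assert (hCF : F <> C) by (intros ->; tauto).
  destruct (perpendicular_erect hP (maps F lF)) as [m' hm'].
  destruct (side_containing l' C' lC') as [S [T [hS sC']]].
  assert (q : exists Q, lies_on Q m' /\ S Q /\ cong (f F) Q F C).
  { destruct hm' as [? [? [? _]]]. apply (point_on_side l' m' S T); auto. }
  destruct q as [Q [mQ [sQ cQ]]].
  (* F itself is treated apart: there the right triangle degenerates. *)
  assert (key : forall Y, lies_on Y l -> cong C Y Q (f Y)).
  { intros Y lY. destruct (classic (Y = F)) as [->|hY]; [cong_flip|].
    assert (hfY : f Y <> f F) by auto.
    assert (r : right_angle C F Y).
    { apply right_angle_sym, (perpendicular_right_angle l m); auto. }
    assert (r' : right_angle Q (f F) (f Y)).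
    { apply right_angle_sym, (perpendicular_right_angle l' m'); auto.
      apply (cong_nondegenerate hP) in cQ; intuition. }
    apply (axiom_R1 hP r r'); auto. cong_flip. }
  assert (e : C' = Q).
  { apply (apex_unique A' B' C' Q l' S T); auto.
    - assert (h := key A lA). rewrite fA in h.
      apply (cong_trans hP (C:=A) (D:=C)); cong_flip.
    - assert (h := key B lB). rewrite fB in h.
      apply (cong_trans hP (C:=B) (D:=C)); cong_flip. }
  rewrite e. auto.
Qed.

Lemma copy_map_sym A B A' B' l l' f :
  copy_map A B A' B' l l' f -> copy_map B A B' A' l l' f.
Proof. intros [? ? ? ? ? ? ?]. split; tauto. Qed.

Lemma side_image_sym A B A' B' X X' : side_image A B A' B' X X' -> side_image B A B' A' X X'.
Proof. intros [l [l' [f [h ?]]]]. exists l, l', f. auto using copy_map_sym. Qed.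

(** The two images may come from different maps [f] and [g]; both keep the
    distances from [A] and [B], which forces [f] and [g] to agree on the line. *)
Lemma copy_same_side A B A' B' D D' E E' : A <> B -> A' <> B' -> D <> E ->
  side_image A B A' B' D D' -> side_image A B A' B' E E' -> cong D' E' D E.
Proof.
  intros hAB hAB' hDE [l [l' [f [hf [lD <-]]]]] [k [k' [g [hg [kE <-]]]]].
  destruct hf as [[lA lB] [lA' lB'] maps inj _ cf [fA fB]].
  destruct hg as [[kA kB] [kA' kB'] maps' inj' _ cg [gA gB]].
  assert (k = l) as -> by (apply (line_unique hP hAB); auto).
  assert (k' = l') as -> by (apply (line_unique hP hAB'); auto).
  assert (fE : f E = g E).
  { destruct (classic (E = A)) as [->|hA]; [congruence|].
    destruct (classic (E = B)) as [->|hB]; [congruence|].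
    apply (two_distances_determine A' B' (f E) (g E) l'); auto.
    - apply (cong_trans hP (C:=A) (D:=E)).
      + rewrite <- fA. apply (cong_sym hP); auto.
      + rewrite <- gA; auto.
    - apply (cong_trans hP (C:=B) (D:=E)).
      + rewrite <- fB. apply (cong_sym hP); auto.
      + rewrite <- gB; auto. }
  rewrite <- fE. apply (cong_sym hP); auto.
Qed.

(** Two uses of [copy_apex]: the first, with apex [C], shows that [A'C'D'] is a
    copy of [ACD], and the second applies to this copy with apex [D]. *)
Lemma copy_adjacent_sides A B C A' B' C' D D' E E' : ~ collinear A B C ->
  is_copy A B C A' B' C' -> D <> E ->
  side_image A B A' B' D D' -> side_image A C A' C' E E' -> cong D' E' D E.
Proof.
  intros nc hc hDE [l [l' [f [hf [lD <-]]]]] [k [k' [g [hg [kE <-]]]]].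
  assert (hCD : cong C D C' (f D)) by (apply (copy_apex A B C A' B' C' l l'); auto).
  destruct hc as [nc' [cAB [cBC cAC]]].
  destruct (cong_nondegenerate hP cAC) as [hAC hAC'].
  assert (kAC : lies_on A k /\ lies_on C k) by apply (copy_dom hg).
  destruct kAC as [kA kC].
  destruct hf as [[lA lB] [lA' lB'] maps inj _ cf [fA fB]].
  destruct (classic (D = A)) as [->|hDA].
  { destruct hg as [_ _ _ _ _ cg [gA _]].
    rewrite fA, <- gA. apply (cong_sym hP); auto. }
  apply (cong_sym hP).
  apply (copy_apex A C D A' C' (f D) k k' g); auto.
  - intros [j [jA [jC jD]]]. apply nc. exists l. split; [|split]; auto.
    apply (collinear_on A D C l); auto. exists j; auto.
  - split; [|split; [|split]]; auto.
    + intros [j [jA [jC jD]]]. apply nc'. exists l'. split; [|split]; auto.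
      apply (collinear_on A' (f D) C' l'); auto; [|exists j; auto].
      rewrite <- fA. auto.
    + rewrite <- fA. auto.
Qed.

Lemma collinear_rot A B C : collinear B C A -> collinear A B C.
Proof. intros [l [? [? ?]]]; exists l; auto. Qed.

Lemma collinear_swap A B C : collinear B A C -> collinear A B C.
Proof. intros [l [? [? ?]]]; exists l; auto. Qed.

Lemma is_copy_rot A B C A' B' C' : is_copy A B C A' B' C' -> is_copy B C A B' C' A'.
Proof.
  intros [h [? [? ?]]]. split; [|split; [|split]]; auto; try cong_flip.
  intros h'; apply h, collinear_rot, h'.
Qed.

Lemma is_copy_swap A B C A' B' C' : is_copy A B C A' B' C' -> is_copy B A C B' A' C'.
Proof.
  intros [h [? [? ?]]]. split; [|split; [|split]]; auto; try cong_flip.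
  intros h'; apply h, collinear_swap, h'.
Qed.

End CopiedTriangles.

Theorem theorem4 (P : plane_data) (hP : plane_axioms P)
    (A B C A' B' C' D E D' E' : point P) :
  ~ collinear A B C ->
  is_copy A B C A' B' C' ->
  D <> E ->
  copy_image A B C A' B' C' D D' ->
  copy_image A B C A' B' C' E E' ->
  cong D' E' D E.
Proof.
  intros nc hc hDE hD hE.
  assert (hc' := hc). destruct hc' as [_ [cAB [cBC cAC]]].
  destruct (cong_nondegenerate hP cAB) as [hAB hAB'].
  destruct (cong_nondegenerate hP cBC) as [hBC hBC'].
  destruct (cong_nondegenerate hP cAC) as [hAC hAC'].
  assert (ncB : ~ collinear B A C) by (intros h; apply nc, collinear_swap, h).
  assert (ncC : ~ collinear C A B) by (intros h; apply nc, collinear_rot, collinear_rot, h).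
  assert (hcB := is_copy_swap hP _ _ _ _ _ _ hc).
  assert (hcC := is_copy_rot hP _ _ _ _ _ _ (is_copy_rot hP _ _ _ _ _ _ hc)).
  (* When D and E are on two different sides, both sides are read from their
     common vertex, with D and E exchanged where this puts the sides in the
     order of [copy_adjacent_sides]. *)
  destruct hD as [hD|[hD|hD]], hE as [hE|[hE|hE]].
  - apply (copy_same_side hP A B A' B'); auto.
  - apply (copy_adjacent_sides hP B A C B' A' C'); auto using side_image_sym.
  - apply (copy_adjacent_sides hP A B C A' B' C'); auto.
  - apply (cong_undirected hP), (cong_swap hP).
    apply (copy_adjacent_sides hP B A C B' A' C'); auto using side_image_sym.
  - apply (copy_same_side hP B C B' C'); auto.
  - apply (cong_undirected hP), (cong_swap hP).
    apply (copy_adjacent_sides hP C A B C' A' B'); auto using side_image_sym.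
  - apply (cong_undirected hP), (cong_swap hP).
    apply (copy_adjacent_sides hP A B C A' B' C'); auto.
  - apply (copy_adjacent_sides hP C A B C' A' B'); auto using side_image_sym.
  - apply (copy_same_side hP A C A' C'); auto.
Qed.
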